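(* Let $M_n=n^b$ and $\alpha_n=n^\omega$ with $0<\omega<1$. If $\frac12>b>\omega$, then $$r_1(n)=\frac{\left(1-\frac1{M_n}\right)^n\left(\frac{\alpha_n+M_n}{\alpha_n}\right)^{M_n}}{\left(\frac{\alpha_n}{\alpha_n+n}\right)^2}\longrightarrow0\qquad(n\to\infty).$$ *)

(* Defs.v *)
From Stdlib Require Import Reals.
From Coquelicot Require Import Coquelicot.
Open Scope R_scope.

(* Real powers use [Rpower], which is the usual x^y for 0 < x; at n = 0 it takes
   a conventional value that does not affect limits as n tends to infinity. *)
Definition M (b : R) (n : nat) : R := Rpower (INR n) b.

Definition alpha (omega : R) (n : nat) : R := Rpower (INR n) omega.

Definition r1 (b omega : R) (n : nat) : R :=
  ((1 - 1 / M b n) ^ n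
   * Rpower ((alpha omega n + M b n) / alpha omega n) (M b n))
  / (alpha omega n / (alpha omega n + INR n)) ^ 2.

(* Main.v *)
Require Import Defs.
From Stdlib Require Import Reals Lra.
From Coquelicot Require Import Coquelicot.
Open Scope R_scope.

(** Write [L = ln n] and [d = 1 - 2b > 0].  The three factors are at most
    [exp (- n^b n^d)], [exp (n^b (1 + L))] and [exp (2 + 2 L)].  Since [n^b >= 1],
    the exponent of the product is at most [n^b (3 + 3 L - n^d)], and
    [n^d = exp (d L)] eventually exceeds [3 + 4 L], so that the product is
    eventually at most [exp (- L) = 1 / n]. *)

Lemma exp_le (x y : R) : x <= y -> exp x <= exp y.
Proof.
  intros [H | ->].
  - left; now apply exp_increasing.
  - right; reflexivity.
Qed.

Lemma exp_pow (x : R) (n : nat) : exp x ^ n = exp (INR n * x).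
Proof.
  rewrite <- Rpower_pow by apply exp_pos.
  unfold Rpower; now rewrite ln_exp.
Qed.

(** Square the tangent-line bound [1 + y / 2 <= exp (y / 2)]; a linear bound would not beat [4 * L]
    for small [d]. *)
Lemma exp_ge_sqr (y : R) : 0 <= y -> y ^ 2 / 4 <= exp y.
Proof.
  intros Hy.
  replace (exp y) with (exp (y / 2) ^ 2) by (rewrite exp_pow; f_equal; simpl; field).
  pose proof (exp_ineq1_le (y / 2)).
  nra.
Qed.

(** The constant is 28 = 4 * 7: the quadratic bound gives [(d * L) ^ 2 / 4 >= 7 * L], and
    [7 * L >= 3 + 4 * L] once [L >= 1]. *)
Lemma exp_eventually_dominates (d L : R) :
  0 < d -> 1 <= L -> 28 / d ^ 2 <= L -> 3 + 4 * L <= exp (d * L).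
Proof.
  intros Hd HL1 HL.
  apply Rle_trans with ((d * L) ^ 2 / 4).
  2: apply exp_ge_sqr; nra.
  assert (H : 28 <= d ^ 2 * L).
  { replace 28 with (d ^ 2 * (28 / d ^ 2)) by (field; lra).
    apply Rmult_le_compat_l; [nra | exact HL]. }
  nra.
Qed.

(** This is [1 - x <= exp (- x)] raised to the power [n]; [1 <= m] keeps the base nonnegative, so
    that powers are monotone. *)
Lemma survival_factor_le (m : R) (n : nat) :
  1 <= m -> 0 <= (1 - 1 / m) ^ n <= exp (- (INR n / m)).
Proof.
  intros Hm.
  assert (H : 0 <= 1 - 1 / m).
  { assert (/ m <= / 1) by (apply Rinv_le_contravar; lra).
    unfold Rdiv; lra. }
  split; [now apply pow_le |].
  replace (- (INR n / m)) with (INR n * (- (1 / m))) by (field; lra).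
  rewrite <- exp_pow.
  apply pow_incr; split; [exact H |].
  pose proof (exp_ineq1_le (- (1 / m))); lra.
Qed.

Lemma growth_factor_le (b omega L m : R) :
  0 <= L -> b - omega <= 1 -> 0 <= m ->
  Rpower ((exp (omega * L) + exp (b * L)) / exp (omega * L)) m
    <= exp (m * (1 + L)).
Proof.
  intros HL Hbo Hm.
  pose proof (exp_pos (omega * L)) as Ha.
  pose proof (exp_pos (b * L)) as Hb.
  assert (Hq : (exp (omega * L) + exp (b * L)) / exp (omega * L)
               = 1 + exp ((b - omega) * L)).
  { replace (b * L) with (omega * L + (b - omega) * L) by ring.
    rewrite exp_plus; field; lra. }
  rewrite Hq.
  unfold Rpower; apply exp_le, Rmult_le_compat_l; [exact Hm |].
  rewrite <- (ln_exp (1 + L)).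
  pose proof (exp_pos ((b - omega) * L)).
  apply ln_le; [lra |].
  rewrite exp_plus.
  (* Hence the base is at most [1 + exp L <= 2 * exp L <= exp (1 + L)]. *)
  assert (exp ((b - omega) * L) <= exp L) by (apply exp_le; nra).
  pose proof (exp_ineq1_le 1).
  pose proof (exp_ineq1_le L).
  nra.
Qed.

(** The inverse is [(1 + exp L / a) ^ 2], and [1 + exp L <= exp (1 + L)] as in the growth factor. *)
Lemma inv_sqr_ratio_le (a L : R) :
  1 <= a -> 0 <= L -> 0 < / (a / (a + exp L)) ^ 2 <= exp (2 + 2 * L).
Proof.
  intros Ha HL.
  pose proof (exp_ineq1_le L) as HeL.
  split.
  - apply Rinv_0_lt_compat, pow_lt, Rdiv_lt_0_compat; lra.
  - replace (/ (a / (a + exp L)) ^ 2) with ((1 + exp L / a) ^ 2) by (field; lra).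
    replace (2 + 2 * L) with (INR 2 * (1 + L)) by (simpl; ring).
    rewrite <- exp_pow.
    assert (Hq : 0 <= exp L / a <= exp L).
    { split; [apply Rdiv_le_0_compat; lra |].
      apply Rle_div_l; nra. }
    apply pow_incr; split; [lra |].
    rewrite exp_plus.
    pose proof (exp_ineq1_le 1).
    nra.
Qed.

Lemma r1_bounds (b omega : R) (n : nat) :
  0 < omega -> omega < b < 1 / 2 ->
  1 <= ln (INR n) -> 28 / (1 - 2 * b) ^ 2 <= ln (INR n) -> 0 < INR n ->
  0 <= r1 b omega n <= / INR n.
Proof.
  intros Ho Hb HL1 HL Hn.
  unfold r1, M, alpha.
  change (Rpower (INR n) b) with (exp (b * ln (INR n))).
  change (Rpower (INR n) omega) with (exp (omega * ln (INR n))).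
  set (L := ln (INR n)) in *.
  assert (HnL : INR n = exp L) by (symmetry; now apply exp_ln).
  set (m := exp (b * L)).
  assert (Hm : 1 <= m) by (pose proof (exp_ineq1_le (b * L)); unfold m; nra).
  assert (Ha : 1 <= exp (omega * L)) by (pose proof (exp_ineq1_le (omega * L)); nra).
  destruct (survival_factor_le m n Hm) as [A0 A1].
  pose proof (growth_factor_le b omega L m ltac:(lra) ltac:(lra) ltac:(lra)) as B1.
  fold m in B1.
  destruct (inv_sqr_ratio_le (exp (omega * L)) L Ha ltac:(lra)) as [C0 C1].
  rewrite <- HnL in C0, C1.
  pose proof (exp_eventually_dominates (1 - 2 * b) L ltac:(lra) HL1 HL) as HD.
  assert (B0 : 0 <= Rpower ((exp (omega * L) + m) / exp (omega * L)) m)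
    by (left; apply exp_pos).
  (* Only the outer quotient of each copy of the product is opened, so the inner ones still match
     the bounds above. *)
  unfold Rdiv at 1 5.
  split; [apply Rmult_le_pos; [now apply Rmult_le_pos | lra] |].
  eapply Rle_trans.
  { apply Rmult_le_compat; [now apply Rmult_le_pos | lra | | exact C1].
    apply Rmult_le_compat; [exact A0 | exact B0 | exact A1 | exact B1]. }
  rewrite <- !exp_plus.
  replace (/ INR n) with (exp (- L)) by (rewrite HnL; apply exp_Ropp).
  apply exp_le.
  (* The exponents [b], [b] and [1 - 2 * b] sum to 1, and one factor [m] cancels. *)
  assert (Hnm : INR n / m = m * exp ((1 - 2 * b) * L)).
  { rewrite HnL.
    replace L with (b * L + (b * L + (1 - 2 * b) * L)) at 1 by ring.
    rewrite !exp_plus; fold m; field; lra. }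
  rewrite Hnm.
  (* Since [m >= 1], [2 + 2 * L] is at most [m * (2 + 2 * L)]; the fourth [L] in [HD] then leaves
     [- m * L <= - L]. *)
  nra.
Qed.

Theorem lemma7p3 (b omega : R) (homega : 0 < omega < 1) (hb : omega < b < 1 / 2) :
  is_lim_seq (r1 b omega) (Finite 0).
Proof.
  apply is_lim_seq_le_le_loc with (u := fun _ => 0) (w := fun n => / INR n).
  (* Both thresholds on [ln (INR n)] hold as soon as [INR n] exceeds [exp K]. *)
  - set (K := Rmax 1 (28 / (1 - 2 * b) ^ 2)).
    destruct (INR_unbounded (exp K)) as [N HN].
    exists N; intros n Hn.
    apply le_INR in Hn.
    pose proof (exp_pos K).
    assert (HK : K <= ln (INR n)).
    { rewrite <- (ln_exp K); apply ln_le; lra. }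
    assert (HK1 : 1 <= K) by apply Rmax_l.
    assert (HK2 : 28 / (1 - 2 * b) ^ 2 <= K) by apply Rmax_r.
    apply r1_bounds; lra.
  - apply is_lim_seq_const.
  - apply (is_lim_seq_inv INR p_infty); [apply is_lim_seq_INR | discriminate].
Qed.
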